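(* Let $n\ge1$ and let $z_1,\ldots,z_n\in\mathbb{C}$ satisfy $z_1+\cdots+z_n=1$. Then for all integers $s_1,\ldots,s_n\ge0$, $$\sum_{k=1}^{n} z_k^{s_k+1}\sum_{\substack{0\le j_i\le s_i\\ i\ne k}}\frac{\big(s_k+\sum_{i\ne k}j_i\big)!}{s_k!\prod_{i\ne k}j_i!}\prod_{i\ne k}z_i^{j_i}=1,$$ where the inner sum runs over all $(j_i)_{i\ne k}$ with $0\le j_i\le s_i$. *)

(* Defs.v *)
From mathcomp Require Export all_boot all_order all_algebra.
From mathcomp Require Export reals complex.

(* The complex numbers are rendered as R[i] over an arbitrary R : realType      *)
(* (a complete archimedean ordered field, hence unique up to isomorphism).      *)

(* Main.v *)
(** Let [M a] be the multinomial coefficient of [a] times the monomial [z ^ a],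
    and sum it over the box [a i <= s i].  Since
    [z k * M a = b k / (\sum_i b i) * M b] for [b = a + e_k], summing over the
    [a] with [a k < s k] and then over [k] gives the total over the box minus
    the term [M 0 = 1].  As [\sum_k z k = 1], the same double sum is also the
    total minus the contribution of the faces [a k = s k], and that
    contribution is the left-hand side of the theorem. *)
Require Import Defs.
From mathcomp Require Import ring.
Import GRing.Theory Num.Theory.
Local Open Scope ring_scope.
Local Open Scope complex_scope.

Section MultinomialBox.

Variables (F : numFieldType) (I : finType) (z : I -> F).
Implicit Types (a : I -> nat) (k : I).

Definition multinomial_term a : F :=
  (\sum_i a i)`!%:R / (\prod_i (a i)`!)%:R * \prod_i z i ^+ a i.

Definition incr_at k a : I -> nat := fun i => ((i == k) + a i)%N.

Lemma sum_incr_at k a : (\sum_i incr_at k a i = (\sum_i a i).+1)%N.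
Proof.
rewrite /incr_at big_split /= (bigD1 k) //= eqxx big1 ?addn0 //.
by move=> i /negbTE ->.
Qed.

Lemma natr_fact_neq0 m : (m`!)%:R != 0 :> F.
Proof. by rewrite pnatr_eq0 -lt0n fact_gt0. Qed.

Lemma natr_prod_fact_neq0 (P : pred I) a :
  (\prod_(i | P i) (a i)`!)%:R != 0 :> F.
Proof.
by rewrite natr_prod; apply/prodf_neq0 => i _; apply: natr_fact_neq0.
Qed.

(** Passing from [a] to [incr_at k a] multiplies the factorial of the sum by the new sum, the
    denominator by the new [k]-th entry and the monomial by [z k]; the quotient in front undoes the
    first two. *)
Lemma mul_multinomial_term k a :
  z k * multinomial_term a =
  (incr_at k a k)%:R / (\sum_i incr_at k a i)%:R *
    multinomial_term (incr_at k a).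
Proof.
rewrite /multinomial_term sum_incr_at factS.
rewrite (bigD1 k (F := fun i => (a i)`!)) //=.
rewrite (bigD1 k (F := fun i => (incr_at k a i)`!)) //=.
rewrite (bigD1 k (F := fun i => z i ^+ a i)) //=.
rewrite (bigD1 k (F := fun i => z i ^+ incr_at k a i)) //=.
have off i : i != k -> incr_at k a i = a i by rewrite /incr_at => /negbTE ->.
have -> : (\prod_(i | i != k) (incr_at k a i)`! =
           \prod_(i | i != k) (a i)`!)%N by apply: eq_bigr => i /off ->.
have -> : \prod_(i | i != k) z i ^+ incr_at k a i =
          \prod_(i | i != k) z i ^+ a i by apply: eq_bigr => i /off ->.
rewrite /incr_at eqxx add1n factS exprS !natrM.
have B0 := natr_fact_neq0 (a k); have P0 := natr_prod_fact_neq0 (fun i => i != k) a.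
by field; rewrite P0 B0 !nat1r !pnatr_eq0.
Qed.

(* [m] only serves to place the box [a i <= s i] in a non-dependent function
   type. *)
Variables (s : I -> nat) (m : nat).
Hypothesis box_bound : forall i, (s i <= m)%N.
Local Notation box := {ffun I -> 'I_m.+1}.

Definition in_box (a : box) := [forall i, a i <= s i]%N.

(** Incrementing the [k]-th entry maps the points with [a k < s k] bijectively onto those with
    positive [k]-th entry. The other points on the right have coefficient 0, even the origin, since
    0 / 0 is 0 here. *)
Lemma sum_box_incr k :
  \sum_(a : box | in_box a && (a k < s k)%N)
     z k * multinomial_term (fun i => a i) =
  \sum_(a : box | in_box a)
     (a k)%:R / (\sum_i a i)%:R * multinomial_term (fun i => a i).
Proof.
rewrite [RHS](bigID (fun a : box => 0 < a k)%N) /=.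
rewrite [X in _ = _ + X]big1 ?addr0; last first.
  by move=> a /andP[_]; rewrite -eqn0Ngt => /eqP ->; rewrite !mul0r.
pose up (a : box) : box :=
  [ffun i => inord ((i == k) + a i)%N].
pose down (a : box) : box :=
  [ffun i => inord (a i - (i == k))%N].
have downE (a : box) i : down a i = (a i - (i == k))%N :> nat.
  by rewrite ffunE inordK // ltnS (leq_trans (leq_subr _ _)) // -ltnS.
have upE (a : box) i : in_box a -> (a k < s k)%N -> up a i = incr_at k (fun i => a i) i :> nat.
  move=> /forallP ba ak; rewrite ffunE inordK // ltnS.
  apply: leq_trans (box_bound i).
  by case: (eqVneq i k) => [->|_]; rewrite ?add1n ?add0n.
rewrite [RHS](reindex_onto up down) /=; last first.
  move=> a /andP[/forallP ba ak]; apply/ffunP => i; apply/val_inj.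
  rewrite /= ffunE inordK downE; case: eqP => [->|_] /=;
    by rewrite ?subn0 ?add0n // subnKC.
apply: eq_big => [a|a /andP[ba ak]]; last first.
  rewrite mul_multinomial_term -upE //; congr (_ / _%:R * _).
    by apply: eq_bigr => i _; rewrite upE.
  rewrite /multinomial_term; congr (_`!%:R / _%:R * _).
  - by apply: eq_bigr => i _; rewrite upE.
  - by apply: eq_bigr => i _; rewrite upE.
  - by apply: eq_bigr => i _; rewrite upE.
apply/andP/andP => [[ba ak]|[/andP[/forallP bu uk] /eqP du]].
  split; last first.
    apply/eqP/ffunP => i; apply/val_inj; rewrite /= downE upE //.
    by rewrite /incr_at addKn.
  rewrite upE // /incr_at eqxx andbT; apply/forallP => i.
  rewrite upE // /incr_at; case: eqP => [->|_] //=.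
  by rewrite add0n; apply/forallP: i.
(* [upE] presupposes [in_box a], which is still to be shown, and [inord] sends overflowing values to
   0; so [a] is recovered from [down (up a) = a] instead. *)
have aE i : a i = (up a i - (i == k))%N :> nat by rewrite -{1}du downE.
split.
  by apply/forallP => i; rewrite aE (leq_trans (leq_subr _ _)).
by rewrite aE eqxx -(prednK uk) subn1 /= prednK.
Qed.

Lemma sum_box_faces :
  \sum_k z k = 1 ->
  \sum_k \sum_(a : box | in_box a && (a k == s k :> nat))
     z k * multinomial_term (fun i => a i) = 1.
Proof.
move=> hz; pose S := \sum_(a : box | in_box a) multinomial_term (fun i => a i).
have split_k k : \sum_(a : box | in_box a && (a k == s k :> nat))
     z k * multinomial_term (fun i => a i) =
  z k * S - \sum_(a : box | in_box a && (a k < s k)%N)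
     z k * multinomial_term (fun i => a i).
  rewrite /S mulr_sumr.
  rewrite [X in X - _](bigID (fun a : box => a k == s k :> nat)) /=.
  rewrite [X in _ + X - _](eq_bigl (fun a : box =>
    in_box a && (a k < s k)%N)) ?addrK // => a.
  by case: (boolP (in_box a)) => //= /forallP/(_ k); rewrite ltn_neqAle => ->; rewrite andbT.
under eq_bigr do rewrite split_k sum_box_incr.
rewrite sumrB -mulr_suml hz mul1r exchange_big /=.
under [X in S - X]eq_bigr do rewrite -!mulr_suml -natr_sum.
(* The coefficient in the subtracted sum is now the sum of the entries divided by itself: 1 except
   at the origin [o], where it is 0 / 0 = 0. Only the term of [S] at [o] survives. *)
pose o : box := [ffun => ord0].
have bo : in_box o by apply/forallP => i; rewrite ffunE.
rewrite /S (bigD1 o) //= [X in _ - X](bigD1 o) //=.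
have o0 : (\sum_i o i = 0)%N by rewrite big1 // => i _; rewrite ffunE.
rewrite o0 !mul0r add0r.
rewrite [X in _ - X](eq_bigr (fun a : box => multinomial_term (fun i => a i))).
  rewrite addrK /multinomial_term o0 !big1 ?divr1 ?mulr1 //;
  by move=> i _; rewrite ffunE.
move=> a /andP[_ ao]; rewrite divff ?mul1r // pnatr_eq0 sum_nat_eq0.
apply: contra ao => /forallP a0; apply/eqP/ffunP => i; apply/val_inj.
by rewrite /= ffunE; apply/eqP: (a0 i).
Qed.

(** A point of the face is determined by its entries off [k], and these range freely over the
    intervals from 0 to [s i]. *)
Lemma sum_face k :
  \sum_(a : box | in_box a && (a k == s k :> nat))
     z k * multinomial_term (fun i => a i) =
  z k ^+ (s k).+1 *
    (\sum_(j : {dffun forall i : {i : I | i != k}, 'I_(s (val i)).+1})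
        ((s k + \sum_(i : {i : I | i != k}) j i)`!%:R
           / ((s k)`! * \prod_(i : {i : I | i != k}) (j i)`!)%:R)
        * \prod_(i : {i : I | i != k}) z (val i) ^+ j i).
Proof.
rewrite mulr_sumr.
pose J := {dffun forall i : {i : I | i != k}, 'I_(s (val i)).+1}.
(* [insub i] succeeds exactly when [i != k]; at [k] the forced value [s k] is inserted. *)
pose ext (j : J) : box :=
  [ffun i => if insub i is Some u then inord (j u) else inord (s k)].
pose res (a : box) : J :=
  [ffun u : {i : I | i != k} => inord (a (val u)) : 'I_(s (val u)).+1].
have extk j : ext j k = s k :> nat.
  by rewrite ffunE insubF ?eqxx // inordK // ltnS box_bound.
have extE j (u : {i : I | i != k}) : ext j (val u) = j u :> nat.
  by rewrite ffunE valK inordK // ltnS (leq_trans _ (box_bound (val u))) // -ltnS.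
have off (i : I) : i != k -> exists u : {i : I | i != k}, i = val u.
  by move=> ik; exists (Sub i ik); rewrite SubK.
rewrite (reindex_onto ext res) /=; last first.
  move=> a /andP[/forallP ba /eqP ak]; apply/ffunP => i; apply/val_inj => /=.
  have [->|/off[u ->]] := eqVneq i k; first by rewrite extk.
  by rewrite extE ffunE inordK // ltnS.
apply: eq_big => [j|j _].
  rewrite extk eqxx andbT; apply/andP; split.
    apply/forallP => i; have [->|/off[u ->]] := eqVneq i k; first by rewrite extk.
    by rewrite extE -ltnS.
  by apply/eqP/ffunP => u; apply/val_inj; rewrite ffunE /= inordK extE.
(* A general commutative law lets one statement serve the sum of the entries, the product of
   factorials and the monomial. *)
have split_k (T : Type) (x : T) (op : Monoid.com_law x) (f : I -> nat -> T) :
    \big[op/x]_i f i (ext j i) =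
    op (f k (s k)) (\big[op/x]_(u : {i : I | i != k}) f (val u) (j u)).
  rewrite (bigD1 k) //= extk (big_sub (fun i => i != k)); congr (op _ _).
  by apply: eq_bigr => u _; rewrite extE.
rewrite /multinomial_term (split_k _ _ _ (fun _ => id)).
rewrite (split_k _ _ _ (fun _ e => e`!)) (split_k _ _ _ (fun i e => z i ^+ e)).
by rewrite /= [_ / _ * (_ * _)]mulrCA exprS -!mulrA.
Qed.

End MultinomialBox.

Theorem theorem6 (R : realType) (n : nat) (hn : (1 <= n)%N)
    (z : 'I_n -> R[i]) (hz : \sum_(k < n) z k = 1) (s : 'I_n -> nat) :
  \sum_(k < n) z k ^+ (s k).+1 *
    (\sum_(j : {dffun forall i : {i : 'I_n | i != k}, 'I_(s (val i)).+1})
        ((s k + \sum_(i : {i : 'I_n | i != k}) j i)`!%:R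
           / ((s k)`! * \prod_(i : {i : 'I_n | i != k}) (j i)`!)%:R)
        * \prod_(i : {i : 'I_n | i != k}) z (val i) ^+ j i) = 1.
Proof.
(* The sum of all [s i] is taken as the common bound [m]. *)
have bound i : (s i <= \sum_i s i)%N by rewrite (bigD1 i) //= leq_addr.
under eq_bigr do rewrite -(sum_face _ _ z _ _ bound).
exact: sum_box_faces bound hz.
Qed.
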